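(* Let $A\in\mathbb{X}^{m\times n}$ be any column regular matrix and $\mathbf{d}\in\mathbb{X}^m$ any nonzero vector such that $A$ is consistent with $\mathbf{d}$, and let $\Delta=\Delta_A(\mathbf{d})$. Consider the equation $A\mathbf{x}=\mathbf{d}$ in the unknown vector $\mathbf{x}\in\mathbb{X}^n$. Then: 1. The equation has solutions if and only if $\Delta=\mathbf{1}$. 2. If solvable, the equation has a maximal solution $\mathbf{x}=(\mathbf{d}^-A)^-$. 3. If all columns in $A$ form a minimal generating system for $\mathbf{d}$, then the solution $\mathbf{x}=(\mathbf{d}^-A)^-$ is unique.
   Context: $\langle\mathbb{X},\mathbf{0},\mathbf{1},\oplus,\otimes\rangle$ is a linearly ordered radicable idempotent semifield: a commutative semiring with zero $\mathbf{0}$ and identity $\mathbf{1}$ in which $x\oplus x=x$ for all $x$, every nonzero $x$ has a multiplicative inverse $x^{-1}$, the power $x^q$ is defined for every nonzero $x$ and rational $q$, and the relation $x\le y\iff x\oplus y=y$ is a linear order. The sign $\otimes$ is omitted. $\mathbb{X}$ includes (or is extended by) a maximal element $\infty$, so that $x\le\infty$ for all $x\in\mathbb{X}$. Vector and matrix operations over $\mathbb{X}$ follow the usual rules with $\oplus,\otimes$ in place of $+,\times$; vector inequalities are component-wise. For a column (row) vector $\mathbf{x}=(x_i)$, $\mathbf{x}^-$ is the row (column) vector with components $x_i^-=x_i^{-1}$ if $x_i\neq\mathbf{0}$ and $x_i^-=\mathbf{0}$ otherwise. A matrix is row (column) regular if it has no zero rows (columns). A solution $\mathbf{x}_0$ of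 the equation is called maximal if $\mathbf{x}\le\mathbf{x}_0$ for any solution $\mathbf{x}$. Consistency: let $I=\{i: d_i=\mathbf{0}\}$ and $J=\{j: a_{ij}>\mathbf{0}\text{ for some } i\in I\}$. $A=(a_{ij})$ is consistent with $\mathbf{d}$ if $a_{ij}=\mathbf{0}$ whenever $i\notin I$ and $j\in J$. Residual: for consistent $A$ and $\mathbf{d}$, $\Delta_A(\mathbf{d})=\big((A(\mathbf{d}^-A)^-)^-\mathbf{d}\big)^{1/2}$ if $A$ is row regular, and $\Delta_A(\mathbf{d})=\infty$ otherwise. A system of nonzero vectors $\mathbf{a}_1,\ldots,\mathbf{a}_n$ is a minimal generating system for $\mathbf{d}$ if $\mathbf{d}$ is a linear combination $x_1\mathbf{a}_1\oplus\cdots\oplus x_n\mathbf{a}_n$ with $x_i\in\mathbb{X}$, and $\mathbf{d}$ is not a linear combination of the vectors of any proper subsystem.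
   Formalization: Item 1 is proved under the added condition that A has no zero row i with d_i = 0; without it item 1 fails: for A = d = (1,0)^T, x = 1 is a solution, but A is not row regular, so Δ = ∞. Items 2 and 3 are unchanged. *)

(* Defs.v *)
From HB Require Import structures.
From mathcomp Require Import all_boot all_order all_algebra.

Set Implicit Arguments.
Unset Strict Implicit.
Unset Printing Implicit Defensive.

Import GRing.Theory.
Local Open Scope ring_scope.

(* Linearly ordered radicable idempotent semifields, with the semiring sum    *)
(* [x + y] as the idempotent addition. The relation [x + y == y] is a partial *)
(* order in any idempotent commutative semiring, so that linearity amounts to *)
(* totality. [sinv x] and [rpow x q] are meaningful only for [x != 0]. The    *)
(* last two axioms determine [rpow x : rat -> X] for [x != 0], because roots  *)
(* are unique in a linearly ordered group; the remaining laws of exponents    *)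
(* follow from them.                                                          *)
HB.mixin Record isLinRadicableSemifield X of GRing.ComNzSemiRing X := {
  saddxx : forall x : X, x + x = x ;
  sle_total : total (fun x y : X => x + y == y) ;
  sinv : X -> X ;
  smulV : forall x : X, x != 0 -> x * sinv x = 1 ;
  rpow : X -> rat -> X ;
  rpow1 : forall x : X, x != 0 -> rpow x 1 = x ;
  rpowD : forall (x : X) (p q : rat),
    x != 0 -> rpow x (p + q) = rpow x p * rpow x q
}.

#[short(type="linSemifieldType")]
HB.structure Definition LinRadicableSemifield :=
  { X of isLinRadicableSemifield X & GRing.ComNzSemiRing X }.

Definition sle (X : linSemifieldType) (x y : X) : bool := x + y == y.
Definition slt (X : linSemifieldType) (x y : X) : bool := (x != y) && sle x y.

(* [X] extended by a new maximal element: [None] is infinity. A maximal       *)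
(* element inside [X] could only be 1 (then [X] = {0, 1}), since              *)
(* infinity * infinity <= infinity with infinity invertible.                  *)
Definition extended (X : linSemifieldType) : Type := option X.
Definition infty (X : linSemifieldType) : extended X := None.

Definition inv_transpose (X : linSemifieldType) (m n : nat) (A : 'M[X]_(m, n)) :
    'M[X]_(n, m) :=
  \matrix_(i, j) (if A j i == 0 then 0 else sinv (A j i)).

Definition mx_le (X : linSemifieldType) (m n : nat) (A B : 'M[X]_(m, n)) : Prop :=
  forall i j, sle (A i j) (B i j).

Definition row_regular (X : linSemifieldType) (m n : nat) (A : 'M[X]_(m, n)) :
    bool :=
  [forall i, row i A != 0].

Definition col_regular (X : linSemifieldType) (m n : nat) (A : 'M[X]_(m, n)) :
    bool :=
  [forall j, col j A != 0].

Definition zero_rows (X : linSemifieldType) (m : nat) (d : 'cV[X]_m) :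
    {set 'I_m} :=
  [set i | d i 0 == 0].

Definition zero_cols (X : linSemifieldType) (m n : nat)
    (A : 'M[X]_(m, n)) (d : 'cV[X]_m) : {set 'I_n} :=
  [set j | [exists i in zero_rows d, slt 0 (A i j)]].

Definition consistent (X : linSemifieldType) (m n : nat)
    (A : 'M[X]_(m, n)) (d : 'cV[X]_m) : Prop :=
  forall i j, i \notin zero_rows d -> j \in zero_cols A d -> A i j = 0.

Definition residual (X : linSemifieldType) (m n : nat)
    (A : 'M[X]_(m, n)) (d : 'cV[X]_m) : extended X :=
  if row_regular A
  then Some (rpow
    ((inv_transpose (A *m inv_transpose (inv_transpose d *m A)) *m d) 0 0) (2%:R^-1))
  else infty X.

Definition solvable_eq (X : linSemifieldType) (m n : nat)
    (A : 'M[X]_(m, n)) (d : 'cV[X]_m) : Prop :=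
  exists x : 'cV[X]_n, A *m x = d.

Definition maximal_solution (X : linSemifieldType) (m n : nat)
    (A : 'M[X]_(m, n)) (d : 'cV[X]_m) (x0 : 'cV[X]_n) : Prop :=
  A *m x0 = d /\ forall x : 'cV[X]_n, A *m x = d -> mx_le x x0.

(* Linear combinations of the subsystem of [a] indexed by [S]. *)
Definition lin_comb (X : linSemifieldType) (m n : nat)
    (a : 'I_n -> 'cV[X]_m) (S : {set 'I_n}) (d : 'cV[X]_m) : Prop :=
  exists x : 'I_n -> X, d = \sum_(j in S) x j *: a j.

Definition minimal_generating (X : linSemifieldType) (m n : nat)
    (a : 'I_n -> 'cV[X]_m) (d : 'cV[X]_m) : Prop :=
  [/\ forall j, a j != 0,
      lin_comb a [set: 'I_n] d
    & forall S : {set 'I_n}, S \proper [set: 'I_n] -> ~ lin_comb a S d].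

(* No equation of the system [A *m x = d] reads 0 = 0. The residual of a      *)
(* system with such an equation is infinity, even if the system is solvable,  *)
(* as with A = d = (1, 0)^T, which is consistent and has the solution x = 1.  *)
Definition no_void_equation (X : linSemifieldType) (m n : nat)
    (A : 'M[X]_(m, n)) (d : 'cV[X]_m) : Prop :=
  forall i, d i 0 = 0 -> row i A != 0.

(* Main.v *)
Require Import Defs.
From mathcomp Require Import all_boot all_order all_algebra.
Set Implicit Arguments.
Unset Strict Implicit.
Unset Printing Implicit Defensive.
Import GRing.Theory.
Local Open Scope ring_scope.

(* Write [x0] for [(d^- A)^-]. Consistency and column regularity give         *)
(* [x0_j = 0] exactly when [j] is in [J], whence [A x0 <= d], and every       *)
(* solution [x] satisfies [x <= x0]. So the equation is solvable iff          *)
(* [A x0 >= d], which is what [(A x0)^- d = 1] says.                          *)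
(* If a solution [x] has [x_j < x0_j], no nonzero [d_i] is attained by the    *)
(* term [a_ij x_j], so the columns other than [j] already generate [d].       *)

(** Where [d i 0] is nonzero, the [i]-th equation says that [d_i^-1 a_ij x_j <= 1] for every [j].
    Outside [J], [(d^- A)_j] is the largest of the coefficients [d_i^-1 a_ij], so its inverse is the
    tightest common bound on [x_j]; on [J] an equation with zero right-hand side forces [x_j = 0].
    This gives [mul_x0_le] and [solution_le_x0]. Totality of the order enters twice: it makes 1 the
    only square root of 1, and it lets one of two summands absorb the other in the uniqueness
    argument. *)

Section Semifield.
Variable X : linSemifieldType.
Implicit Types x y z : X.

(** * Order and cancellation in a linearly ordered idempotent semifield *)

Lemma sle_refl x : sle x x.
Proof. by apply/eqP; exact: saddxx. Qed.

Lemma sle_trans y x z : sle x y -> sle y z -> sle x z.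
Proof. by move=> /eqP xy /eqP yz; apply/eqP; rewrite -yz addrA xy. Qed.

Lemma sle_anti x y : sle x y -> sle y x -> x = y.
Proof. by move=> /eqP xy /eqP yx; rewrite -yx addrC xy. Qed.

Lemma sle0x x : sle 0 x.
Proof. by apply/eqP; rewrite add0r. Qed.

Lemma slex0 x : sle x 0 -> x = 0.
Proof. by move/eqP; rewrite addr0. Qed.

Lemma slt0x x : slt 0 x = (x != 0).
Proof. by rewrite /slt sle0x andbT eq_sym. Qed.

Lemma sle_add x y z : sle (x + y) z = sle x z && sle y z.
Proof.
apply/idP/andP => [/eqP xyz | [/eqP xz /eqP yz]].
  split; apply/eqP; rewrite -xyz.
    by rewrite !addrA saddxx.
  by rewrite !addrA (addrC y) -(addrA x) saddxx.
by apply/eqP; rewrite -addrA yz.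
Qed.

(** Idempotent sums are joins, so entries of matrix products are bounded term by term. *)
Lemma sle_sumP (I : finType) (P : pred I) (F : I -> X) z :
  reflect (forall i, P i -> sle (F i) z) (sle (\sum_(i | P i) F i) z).
Proof.
apply: (iffP idP) => [Fz i Pi | Fz].
  by move: Fz; rewrite (bigD1 i) //= sle_add => /andP[].
by elim/big_ind: _ => // [|x y xz yz]; [exact: sle0x | rewrite sle_add xz].
Qed.

Lemma sle_sum_term (I : finType) (F : I -> X) i : sle (F i) (\sum_j F j).
Proof. by move: i (isT : xpredT i); apply/sle_sumP; exact: sle_refl. Qed.

Lemma sle_mul2l z x y : sle x y -> sle (z * x) (z * y).
Proof. by move=> /eqP xy; apply/eqP; rewrite -mulrDr xy. Qed.

Lemma smulVK z x : z != 0 -> sinv z * (z * x) = x.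
Proof. by move=> z0; rewrite mulrA (mulrC (sinv z)) smulV // mul1r. Qed.

Lemma smulKV z x : z != 0 -> z * (sinv z * x) = x.
Proof. by move=> z0; rewrite mulrA smulV // mul1r. Qed.

Lemma sle_pmul2l z x y : z != 0 -> sle (z * x) (z * y) = sle x y.
Proof.
move=> z0; apply/idP/idP; last exact: sle_mul2l.
by move/(sle_mul2l (sinv z)); rewrite !smulVK.
Qed.

Lemma smulf_neq0 x y : x != 0 -> y != 0 -> x * y != 0.
Proof.
move=> x0; apply: contraNneq => xy0.
by rewrite -(smulVK y x0) xy0 mulr0.
Qed.

Lemma sinv_neq0 x : x != 0 -> sinv x != 0.
Proof.
move=> x0; apply: contra_neq (oner_neq0 X) => xV0.
by rewrite -(smulV x x0) xV0 mulr0.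
Qed.

(** Multiplying a comparison of [x] with 1 by [x] yields the opposite comparison. *)
Lemma ssqr_eq1 x : x * x = 1 -> x = 1.
Proof.
move=> xx; case/orP: (sle_total x 1) => [x1 | x1].
  by apply: sle_anti => //; have := sle_mul2l x x1; rewrite xx mulr1.
by apply: sle_anti => //; have := sle_mul2l x x1; rewrite xx mulr1.
Qed.

Lemma rpow_half x : x != 0 -> rpow x 2%:R^-1 * rpow x 2%:R^-1 = x.
Proof. by move=> x0; rewrite -rpowD // [_ + _](_ : _ = 1) ?rpow1. Qed.

Lemma sum_neq0 (I : finType) (F : I -> X) i : F i != 0 -> \sum_j F j != 0.
Proof.
apply: contra_neq => F0; apply: slex0.
by rewrite -F0; exact: sle_sum_term.
Qed.

Lemma mx_neq0P m n (B : 'M[X]_(m, n)) :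
  reflect (exists i j, B i j != 0) (B != 0).
Proof.
apply: (iffP idP) => [B0 | [i [j]]]; last by apply: contraNneq => ->; rewrite mxE.
suff /existsP[i /existsP[j Bij]] : [exists i, [exists j, B i j != 0]].
  by exists i, j.
apply: contraNT B0 => /existsPn B0; apply/eqP/matrixP => i j; rewrite mxE.
by have /existsPn/(_ j) := B0 i; rewrite negbK => /eqP.
Qed.

End Semifield.

(** * The vector [x0] and the bounds it satisfies *)

Section Equation.
Variables (X : linSemifieldType) (m n : nat).
Variables (A : 'M[X]_(m, n)) (d : 'cV[X]_m).
Hypotheses (hA : col_regular A) (hd : d != 0) (hAd : consistent A d).

Let y := inv_transpose d *m A.
Let x0 := inv_transpose y.

Lemma row_regularP : reflect (forall i, exists j, A i j != 0) (row_regular A).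
Proof.
apply: (iffP forallP) => hR i.
  by have /mx_neq0P[k [j]] := hR i; rewrite mxE; exists j.
by have [j Aij] := hR i; apply/mx_neq0P; exists 0, j; rewrite mxE.
Qed.

Lemma zero_colsP j :
  reflect (exists2 i, d i 0 = 0 & A i j != 0) (j \in zero_cols A d).
Proof.
rewrite inE; apply: (iffP exists_inP) => -[i].
  by rewrite inE slt0x => /eqP di Aij; exists i.
by move=> di Aij; exists i; rewrite ?inE ?di ?slt0x.
Qed.

Lemma consistent_zero i j : d i 0 != 0 -> j \in zero_cols A d -> A i j = 0.
Proof. by move=> di; apply: hAd; rewrite inE. Qed.

(** Rows with [d i 0 = 0] are killed by [d^-], the others by consistency. *)
Lemma y_eq0 j : j \in zero_cols A d -> y 0 j = 0.
Proof.
move=> jJ; rewrite mxE big1 // => i _; rewrite mxE.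
by case: eqP => [_|/eqP di]; rewrite ?mul0r // consistent_zero ?mulr0.
Qed.

Lemma y_neq0 j : j \notin zero_cols A d -> y 0 j != 0.
Proof.
move=> jJ; have /mx_neq0P[i [k]] := forallP hA j; rewrite mxE => Aij.
have di : d i 0 != 0.
  by apply: contraNneq jJ => di; apply/zero_colsP; exists i.
rewrite mxE; apply: (@sum_neq0 _ _ _ i); rewrite mxE (negPf di).
by rewrite smulf_neq0 ?sinv_neq0.
Qed.

Lemma x0_eq0 j : j \in zero_cols A d -> x0 j 0 = 0.
Proof. by move=> jJ; rewrite mxE y_eq0 ?eqxx. Qed.

Lemma x0E j : j \notin zero_cols A d -> x0 j 0 = sinv (y 0 j).
Proof. by move=> jJ; rewrite mxE (negPf (y_neq0 jJ)). Qed.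

Lemma term_le_y i j : d i 0 != 0 -> sle (sinv (d i 0) * A i j) (y 0 j).
Proof.
move=> di; rewrite mxE; have := sle_sum_term
  (fun k => inv_transpose d 0 k * A k j) i.
by rewrite mxE (negPf di).
Qed.

(** If [d i 0 = 0], each term vanishes: [x0_j = 0] on [J], and [a_ij = 0] off [J]. Otherwise, off
    [J], the bound on a term amounts to [d_i^-1 a_ij <= y_j]. *)
Lemma mul_x0_le i : sle ((A *m x0) i 0) (d i 0).
Proof.
rewrite mxE; apply/sle_sumP => j _.
have [jJ | jJ] := boolP (j \in zero_cols A d).
  by rewrite x0_eq0 // mulr0 sle0x.
have [di | di] := eqVneq (d i 0) 0.
  have [-> | Aij] := eqVneq (A i j) 0; first by rewrite mul0r sle0x.
  by case/zero_colsP: jJ; exists i.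
rewrite -(sle_pmul2l _ _ (sinv_neq0 di)) mulrA (mulrC (sinv _) (d _ _)) smulV //.
(* The right-hand side 1 becomes [y_j y_j^-1], so that both sides share the factor [y_j^-1]. *)
rewrite x0E // -(smulV _ (y_neq0 jJ)) ![_ * sinv (y _ _)]mulrC.
exact/sle_mul2l/term_le_y.
Qed.

Lemma solution_le_x0 x : A *m x = d -> mx_le x x0.
Proof.
move=> Ax j k; rewrite (ord1 k) {k}.
have Axd i : sle (A i j * x j 0) (d i 0).
  by rewrite -Ax mxE; apply: (sle_sum_term (fun j => A i j * x j 0)).
have [jJ | jJ] := boolP (j \in zero_cols A d).
  case/zero_colsP: (jJ) => i di Aij; have := Axd i; rewrite di => /slex0 Axj.
  suff -> : x j 0 = 0 by exact: sle0x.
  by apply/eqP; apply: contra_eqT Axj => xj; exact: smulf_neq0.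
(* It remains to bound [y_j x_j] by 1, one term [d_i^-1 a_ij x_j] at a time. *)
rewrite x0E // -(sle_pmul2l _ _ (y_neq0 jJ)) smulV ?y_neq0 //.
rewrite mxE mulr_suml; apply/sle_sumP => i _.
rewrite mxE; case: eqVneq => [_|di]; first by rewrite !mul0r sle0x.
by rewrite -(sle_pmul2l _ _ di) mulr1 -mulrA smulKV.
Qed.

(** * Solvability and the residual *)

Lemma solvable_maximal : solvable_eq A d -> maximal_solution A d x0.
Proof.
case=> x Ax; split; last exact: solution_le_x0.
apply/matrixP => i k; rewrite (ord1 k); apply: sle_anti; first exact: mul_x0_le.
rewrite -Ax !mxE; apply/sle_sumP => j _.
apply: sle_trans (sle_sum_term (fun j => A i j * x0 j 0) j).
exact/sle_mul2l/solution_le_x0.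
Qed.

(** By consistency a nonzero [a_ij] in such a row lies off [J], where [x0_j] is invertible. Hence
    [(A x0)^-] has a true inverse there, not the default 0. *)
Lemma mul_x0_neq0 i : row_regular A -> d i 0 != 0 -> (A *m x0) i 0 != 0.
Proof.
move=> /row_regularP/(_ i)[j Aij] di.
rewrite mxE; apply: (@sum_neq0 _ _ _ j); apply: smulf_neq0 => //.
have jJ : j \notin zero_cols A d.
  by apply: contra Aij => jJ; rewrite consistent_zero.
by rewrite x0E // sinv_neq0 ?y_neq0.
Qed.

Lemma inv_transpose_mul_self : (inv_transpose d *m d) 0 0 = 1.
Proof.
have /mx_neq0P[i [k]] := hd; rewrite (ord1 k) => di.
rewrite mxE; apply: sle_anti.
  apply/sle_sumP => j _; rewrite mxE; case: eqVneq => [_|dj].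
    by rewrite mul0r sle0x.
  by rewrite mulrC smulV ?sle_refl.
have := sle_sum_term (fun j => inv_transpose d 0 j * d j 0) i.
by rewrite {1}mxE (negPf di) (mulrC (sinv _)) smulV.
Qed.

Lemma solvable_residual :
  no_void_equation A d -> solvable_eq A d -> residual A d = Some 1.
Proof.
move=> hV hS; have [Ax0 _] := solvable_maximal hS.
have -> : residual A d = if row_regular A
    then Some (rpow ((inv_transpose (A *m x0) *m d) 0 0) 2%:R^-1)
    else infty X by [].
(* [hV] covers the rows with [d i 0 = 0]; any other row is nonzero because [A x0 = d]. *)
have -> : row_regular A.
  apply/forallP => i; have [/hV // | di] := eqVneq (d i 0) 0.
  apply: contra_neq di => Ai; rewrite -Ax0 mxE big1 // => j _.
  by have /rowP/(_ j) := Ai; rewrite !mxE => ->; rewrite mul0r.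
rewrite Ax0 inv_transpose_mul_self; congr Some; apply: ssqr_eq1.
exact/rpow_half/oner_neq0.
Qed.

(** The square of the residual dominates every ratio [d_i / (A x0)_i], so the value 1 gives
    [d <= A x0]. *)
Lemma residual_solvable : residual A d = Some 1 -> solvable_eq A d.
Proof.
rewrite /residual -/y -/x0; case: ifP => // hR [].
set r := (_ *m d) 0 0 => hr.
have rE i : d i 0 != 0 -> sle (sinv ((A *m x0) i 0) * d i 0) r.
  move=> di; rewrite /r [(_ *m d) _ _]mxE.
  have := sle_sum_term (fun j => inv_transpose (A *m x0) 0 j * d j 0) i.
  by rewrite [inv_transpose _ 0 i]mxE (negPf (mul_x0_neq0 hR di)).
have /mx_neq0P[i0 [k]] := hd; rewrite (ord1 k) => di0.
(* [rpow 0] is unspecified, so [r != 0] must be checked first. *)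
have r0 : r != 0.
  apply: contraTneq (rE _ di0) => ->; apply/negP => /slex0/eqP; apply/negP.
  by rewrite smulf_neq0 ?sinv_neq0 ?mul_x0_neq0.
have r1 : r = 1 by rewrite -(rpow_half r0) hr mulr1.
exists x0; apply/matrixP => i l; rewrite (ord1 l) {l}.
apply: sle_anti; first exact: mul_x0_le.
have [-> | di] := eqVneq (d i 0) 0; first exact: sle0x.
have Axi := mul_x0_neq0 hR di.
by have := sle_mul2l ((A *m x0) i 0) (rE _ di); rewrite smulKV // r1 mulr1.
Qed.

(** * Generating systems and uniqueness *)

Lemma lin_comb_mulmx (S : {set 'I_n}) (x : 'cV[X]_n) :
  (forall i, \sum_(j in S) A i j * x j 0 = d i 0) ->
  lin_comb (fun j => col j A) S d.
Proof.
move=> hx; exists (fun j => x j 0); apply/matrixP => i k.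
rewrite (ord1 k) summxE -hx; apply: eq_bigr => j _.
by rewrite !mxE mulrC.
Qed.

Lemma generating_solvable :
  lin_comb (fun j => col j A) [set: 'I_n] d -> solvable_eq A d.
Proof.
case=> x dE; exists (\col_j x j); apply/matrixP => i k.
rewrite (ord1 k) dE summxE mxE; apply: eq_big => [j | j _]; first by rewrite inE.
by rewrite !mxE mulrC.
Qed.

Lemma minimal_unique x :
  minimal_generating (fun j => col j A) d -> A *m x = d -> x = x0.
Proof.
case=> _ /generating_solvable/solvable_maximal[Ax0 x_le] hmin Ax.
apply/matrixP => j k; rewrite (ord1 k) {k}; apply/eqP; apply: contraT => xj.
have jS : [set~ j] \proper [set: 'I_n].
  by rewrite properEneq subsetT andbT; apply/eqP => /setP/(_ j); rewrite !inE eqxx.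
case: (hmin _ jS); apply: (@lin_comb_mulmx _ x) => i.
have splitD (z : 'cV_n) : (A *m z) i 0 =
    A i j * z j 0 + \sum_(l in [set~ j]) A i l * z l 0.
  by rewrite mxE (bigD1 j) //=; congr (_ + _); apply: eq_bigl => l; rewrite !inE.
have := splitD x; rewrite Ax; set S := \sum_(l in _) _ => dE.
(* Either the other columns already attain [d_i], or the term of column [j] does. *)
case/orP: (sle_total (A i j * x j 0) S) => [/eqP AS | /eqP SA].
  by rewrite dE AS.
move: dE; rewrite addrC SA => dE.
have [Aij | Aij] := eqVneq (A i j) 0.
  by rewrite dE -SA Aij mul0r addr0.
(* Now [a_ij x0_j <= d_i = a_ij x_j]; cancelling [a_ij] contradicts that [x_j] differs from
   [x0_j]. *)
case/negP: xj; apply/eqP/sle_anti; first exact: x_le.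
rewrite -(sle_pmul2l _ _ Aij) -dE -Ax0 [(_ *m _) _ _]mxE.
exact: (sle_sum_term (fun l => A i l * x0 l 0)).
Qed.

End Equation.

Theorem theorem2 (X : linSemifieldType) (m n : nat)
    (A : 'M[X]_(m, n)) (d : 'cV[X]_m)
    (hA : col_regular A) (hd : d != 0) (hAd : consistent A d) :
  [/\ no_void_equation A d ->
        (solvable_eq A d <-> residual A d = Some 1),
      solvable_eq A d ->
        maximal_solution A d (inv_transpose (inv_transpose d *m A))
    & minimal_generating (fun j => col j A) d ->
        forall x : 'cV[X]_n,
          A *m x = d <-> x = inv_transpose (inv_transpose d *m A)].
Proof.
split=> [hV | | hmin x].
- by split; [exact: solvable_residual | exact: residual_solvable].
- exact: solvable_maximal.
- split=> [|->]; first exact: minimal_unique.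
  by case: hmin => _ /generating_solvable/(solvable_maximal hA hAd)[].
Qed.
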